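(* Let $(v_0,\dots,v_N)$, $v_n:\widetilde{E}\to\mathbb{R}$, be the solution of Bellman's Equation $$v_N(x,t)=g_N(x,t),\qquad v_n(x,t)=\mathcal{T}_n v_{n+1}(x,t)\quad (n=0,\dots,N-1),\qquad (x,t)\in\widetilde{E},$$ and suppose there exists a policy $\pi^*=(\pi_0^*,\dots,\pi_{N-1}^* )\in F^N$ such that, for any $n=0,\dots,N-1$, $\pi^*_n$ is maximal for $v_{n+1}$ at stage $n$. Then the policy $\pi^*$ is optimal and for any $n=0,\dots,N$ and $(x,t)\in\widetilde{E}$ $$V_n(x,t)=V_{n,\pi^*}(x,t)=v_n(x,t).$$
   Context: Discrete-time semi-Markov decision process: $E$ is a countable state space, $\widetilde{E}=E\times\mathbb{N}_0$ (both with the total $\sigma$-algebra), $A$ is a measurable action space, and for each $(x,t)\in\widetilde{E}$, $D(x,t)\subseteq A$ is a nonempty set of admissible actions; $\mathcal{D}=\{(x,t,a)\in\widetilde{E}\times A:\ a\in D(x,t)\}$. $P$ is a function such that: (I) for every $(x,t,a)\in\mathcal{D}$, $(y,s)\mapsto P(y,s|x,t,a)$ is a probability mass function on $\widetilde{E}$; (II) for every $(y,s)$, $(x,t,a)\mapsto P(y,s|x,t,a)$ is measurable on $\mathcal{D}$; (III) $P(x,s|x,t,a)=0$ whenever $s\neq t+1$; (IV) $P(y,s|x,t,a)=0$ whenever $y\ne x$ and $s\ne 0$. Put $p(x|x,t,a)=P(x,t+1|x,t,a)$ and $p(y|x,t,a)=P(y,0|x,t,a)$ for $y\neq x$. $N\in\mathbb{N}$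 is a fixed horizon. A one-stage reward $\overline{r}_n(x|y,t,a)\in\mathbb{R}$ ($n=0,\dots,N-1$) and a terminal reward $g_N:\widetilde{E}\to\mathbb{R}$ are given; $r_n(y,t,a)=\sum_{x\in E}\overline{r}_n(x|y,t,a)p(x|y,t,a)$. $F$ is the set of decision rules $f:\widetilde{E}\to A$ with $f(x,t)\in D(x,t)$ for all $(x,t)$; a policy is $\pi=(\pi_0,\dots,\pi_{N-1})\in F^N$. For a policy $\pi$, $n\in\{0,\dots,N\}$ and $(x,t)\in\widetilde{E}$, $\mathbb{E}_{\pi,n,(x,t)}$ is expectation under the law of the process $(X_k,\gamma_k)_{k=n,\dots,N}$ with $(X_n,\gamma_n)=(x,t)$ and, for $k=n,\dots,N-1$, conditional probability $P(y,s|X_k,\gamma_k,\pi_k(X_k,\gamma_k))$ of $(X_{k+1},\gamma_{k+1})=(y,s)$ given the past up to time $k$. The value functions are $$V_{n,\pi}(x,t)=\mathbb{E}_{\pi,n,(x,t)}\Big[\sum_{k=n}^{N-1}r_k(X_k,\gamma_k,\pi_k(X_k,\gamma_k))+g_N(X_N,\gamma_N)\Big],\qquad V_n(x,t)=\sup_{\pi\in F^N}V_{n,\pi}(x,t).$$ A policy $\pi^*$ is optimal if $V_n(x,t)=V_{n,\pi^*}(x,t)$ for all $n=0,\dots,N$, $(x,t)\in\widetilde{E}$. For $v:\widetilde{E}\to\mathbb{R}$ and $n\le N-1$: $$L_nv(x,t,a)=r_n(x,t,a)+\sum_{y\in E,\,y\neq x}v(y,0)p(y|x,t,a)+v(x,t+1)p(x|x,t,a),\quad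 (x,t,a)\in\mathcal{D},$$ $\mathcal{T}_{n,f}v(x,t)=L_nv(x,t,f(x,t))$ for $f\in F$, and $\mathcal{T}_nv(x,t)=\sup_{a\in D(x,t)}L_nv(x,t,a)=\sup_{f\in F}\mathcal{T}_{n,f}v(x,t)$. A decision rule $f\in F$ is maximal for $v$ at stage $n$ if $\mathcal{T}_nv(x,t)=\mathcal{T}_{n,f}v(x,t)$ for all $(x,t)\in\widetilde{E}$. Convention: all series and expectations in these definitions are assumed to converge absolutely, so that $r_n$, $V_{n,\pi}$, $L_nv_{n+1}$ and the $v_n$ are well defined and real-valued. *)

(* Defs.v *)
From HB Require Import structures.
From mathcomp Require Import all_boot all_order all_algebra.
From mathcomp Require Import mathcomp_extra boolp classical_sets functions.
From mathcomp Require Import cardinality fsbigop reals ereal topology sequences.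
From mathcomp Require Import normedtype esum numfun measure lebesgue_measure.
From mathcomp Require Import lebesgue_integral probability.

Set Implicit Arguments.
Unset Strict Implicit.
Unset Printing Implicit Defensive.
Import Order.TTheory GRing.Theory Num.Theory.

Local Open Scope classical_set_scope.
Local Open Scope ring_scope.

(* [total_algebra T] is [T] with the total (discrete) sigma-algebra. *)
Definition total_algebra (T : Type) : Type := T.

HB.instance Definition _ (T : pointedType) := Pointed.on (total_algebra T).
HB.instance Definition _ (T : pointedType) :=
  @isMeasurable.Build default_measure_display (total_algebra T) discrete_measurable
    discrete_measurable0 discrete_measurableC discrete_measurableU.

(* Sum of an absolutely convergent series indexed by [D]; meaningful when
   [abs_cvg D f] holds. *)
Definition abs_cvg (R : realType) (T : choiceType) (D : set T) (f : T -> R) :=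
  summable D (EFin \o f).

Definition asum (R : realType) (T : choiceType) (D : set T) (f : T -> R) : R :=
  fine (\esum_(x in D) (EFin \o f)^\+ x - \esum_(x in D) (EFin \o f)^\- x)%E.

(* [trans w z a] is P(w|z,a) for w, z in E x N; its values at inadmissible [a]
   are irrelevant. *)
Record smdp (R : realType) (E : pointedType) (dA : measure_display)
    (A : measurableType dA) := Smdp {
  adm : E * nat -> set A;
  adm_neq0 : forall z, adm z !=set0;
  trans : E * nat -> E * nat -> A -> R;
  trans_ge0 : forall w z a, adm z a -> 0 <= trans w z a;
  trans_sum1 : forall z a, adm z a ->
    (\esum_(w in [set: E * nat]) (trans w z a)%:E)%E = 1%E;
  (* measurability for the trace on {(z, a) | a \in adm z} of the product
     sigma-algebra *)
  trans_measurable : forall (w : E * nat) (B : set R), measurable B ->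
    exists2 M : set (total_algebra (E * nat) * A), measurable M &
      [set q | adm q.1 q.2 /\ B (trans w q.1 q.2)] =
      [set q | adm q.1 q.2] `&` M;
  trans_stay : forall x t s a, adm (x, t) a -> s <> t.+1 ->
    trans (x, s) (x, t) a = 0;
  trans_jump : forall x y t s a, adm (x, t) a -> y <> x -> s <> 0%N ->
    trans (y, s) (x, t) a = 0
}.

Record decision_rule (R : realType) (E : pointedType) (dA : measure_display)
    (A : measurableType dA) (M : smdp R E A) := DecisionRule {
  rule :> E * nat -> A;
  rule_adm : forall z, adm M z (rule z)
}.

Definition policy (R : realType) (E : pointedType) (dA : measure_display)
    (A : measurableType dA) (M : smdp R E A) (N : nat) :=
  'I_N -> decision_rule M.

(* Trajectories (z_n, ..., z_N) are coded as sequences; [process n k] is the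
   random variable (X_k, gamma_k) for a process started at time [n <= k]. *)
Definition traj (E : pointedType) : Type := seq (E * nat).
HB.instance Definition _ (E : pointedType) := Choice.on (traj E).
HB.instance Definition _ (E : pointedType) := isPointed.Build (traj E) [::].

Definition process (E : pointedType) (n k : nat) (w : traj E) : E * nat :=
  nth point w (k - n).

Lemma esumZl (R : realType) (T : choiceType) (D : set T) (c : R)
    (f : T -> \bar R) : 0 <= c -> (forall x, (0 <= f x)%E) ->
  (\esum_(x in D) (c%:E * f x) = c%:E * \esum_(x in D) f x)%E.
Proof.
move=> c0 f0; rewrite /esum -ereal_supZl//; last first.
  by apply/set0P; exists (\sum_(x \in set0) f x)%E, set0 => //; exact: fsets_set0.
congr ereal_sup; apply/seteqP; split => [_ [X DX <-]|_ [_ [X DX <-] <-]].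
  by exists (\sum_(x \in X) f x)%E; [exists X|rewrite ge0_mule_fsumr].
by exists X => //; rewrite ge0_mule_fsumr.
Qed.

Section path_law.
Context (R : realType) (E : pointedType) (dA : measure_display).
Context (A : measurableType dA) (M : smdp R E A) (N : nat).
Implicit Types (pi : policy M N) (n : nat) (z : E * nat).

(* Probability that the process started at time n in z and controlled by pi
   follows the trajectory w up to the horizon. *)
Definition path_pmf pi n z (w : traj E) : R :=
  if (size w == (N - n).+1) && (process n n w == z) then
    \prod_(k < N | (n <= k)%N)
      trans M (process n k.+1 w) (process n k w) (pi k (process n k w))
  else 0.

Lemma path_pmf_ge0 pi n z w : 0 <= path_pmf pi n z w.
Proof.
rewrite /path_pmf; case: ifP => // _; apply: prodr_ge0 => k _.
exact/trans_ge0/rule_adm.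
Qed.

Lemma path_pmf_end pi n z w : (N <= n)%N ->
  path_pmf pi n z w = (w == [:: z])%:R.
Proof.
move=> Nn; rewrite /path_pmf (eqP Nn) /process subnn big_pred0; last first.
  by move=> k; apply/negbTE; rewrite -ltnNge (leq_trans (ltn_ord k)).
by case: w => [|x [|y w]]//=; rewrite ?eqseq_cons ?andbT ?andbF//; case: (x == z).
Qed.

Lemma path_pmf_cons pi n z y w (nN : (n < N)%N) :
  path_pmf pi n z (z :: y :: w) =
  trans M y z (pi (Ordinal nN) z) * path_pmf pi n.+1 y (y :: w).
Proof.
rewrite /path_pmf /process !subnn /= !eqxx !andbT.
rewrite -(subnSK nN) !eqSS; case: ifP => _; last by rewrite mulr0.
rewrite (bigD1 (Ordinal nN))//= subnn subSnn /=; congr (_ * _).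
apply: eq_big => [k|k /andP[nk kn]].
  by rewrite ltn_neqAle andbC eq_sym.
have {kn}nk' : (n < k)%N by rewrite ltn_neqAle nk eq_sym andbT.
by rewrite subSn// subSS -(subnSK nk').
Qed.

Lemma path_pmf_head pi n z w :
  (forall w', w <> z :: w') -> path_pmf pi n z w = 0.
Proof.
rewrite /path_pmf /process subnn; case: w => [|x w] //= wz.
by case: (x =P z) => [xz|]; [have := wz w; rewrite xz|rewrite andbF].
Qed.

Lemma path_pmf_sum1 pi n z :
  (\esum_(w in [set: traj E]) (path_pmf pi n z w)%:E = 1)%E.
Proof.
have only (F : traj E -> \bar R) w0 : (forall w, 0 <= F w)%E ->
    (forall w, w <> w0 -> F w = 0%E) -> (\esum_(w in setT) F w = F w0)%E.
  move=> F0 Fw0; rewrite (esumID [set w0])// setTI esum_set1// setTI.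
  by rewrite [X in (_ + X)%E]esum1 ?adde0// => w /= /Fw0.
move: {2}(N - n)%N (erefl (N - n)%N) => d.
elim: d => [|d IH] in n z *.
  move=> /eqP; rewrite subn_eq0 => Nn.
  rewrite (only _ [:: z]) ?path_pmf_end ?eqxx// => w.
    by rewrite lee_fin path_pmf_ge0.
  by rewrite path_pmf_end// => /eqP/negbTE ->.
move=> Nnd; have nN : (n < N)%N by rewrite -subn_gt0 Nnd.
set a := pi (Ordinal nN) z.
have az : adm M z a by exact: rule_adm.
rewrite (esumID [set z :: w | w in [set: traj E]]); last first.
  by move=> w _; rewrite lee_fin path_pmf_ge0.
rewrite setTI [X in (_ + X)%E]esum1 ?adde0; last first.
  move=> w [_ /= wz]; rewrite path_pmf_head// => w' ww'.
  by apply: wz; exists w'.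
rewrite esum_image; last by move=> w1 w2 _ _ [].
transitivity (\esum_(w in [set: traj E]) \esum_(y in [set: E * nat])
   ((trans M y z a)%:E * (path_pmf pi n.+1 y w)%:E))%E.
  apply: eq_esum => -[|y w] _.
    rewrite esum1; last by move=> y _; rewrite path_pmf_head ?mule0.
    rewrite /path_pmf /=.
    by rewrite -(subnSK nN).
  rewrite (esumID [set y]); last first.
    move=> x _; rewrite mule_ge0 ?lee_fin ?path_pmf_ge0//.
    exact: trans_ge0.
  rewrite setTI esum_set1; last first.
    by rewrite mule_ge0 ?lee_fin ?path_pmf_ge0//; exact: trans_ge0.
  rewrite [X in (_ + X)%E]esum1 ?adde0; last first.
    by move=> x [_ /= yx]; rewrite path_pmf_head ?mule0// => w' [yx' _]; exact/yx/esym.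
  by rewrite (path_pmf_cons pi z y w nN).
have ge0 y w : (0 <= (trans M y z a)%:E * (path_pmf pi n.+1 y w)%:E)%E.
  by rewrite mule_ge0 ?lee_fin ?path_pmf_ge0//; exact: trans_ge0.
rewrite esum_esum//.
rewrite (reindex_esum ([set: E * nat] `*`` fun=> [set: traj E]) _
  (fun q => (q.2, q.1))) /=; last first.
  by split => // [[? ?] [? ?] _ _ [-> ->]|[w y] _] //; exists (y, w).
rewrite -(esum_esum (I := [set: E * nat]) (J := fun=> [set: traj E])
  (a := fun y w => ((trans M y z a)%:E * (path_pmf pi n.+1 y w)%:E)%E))//.
have Nnd' : (N - n.+1)%N = d by rewrite subnS Nnd.
rewrite -(trans_sum1 az); apply: eq_esum => y _.
rewrite esumZl; first by rewrite IH ?mule1.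
- exact: trans_ge0.
- by move=> w; rewrite lee_fin path_pmf_ge0.
Qed.

(* Law of the trajectory ((X_n, gamma_n), ..., (X_N, gamma_N)). *)
Definition path_law pi n z (S : set (total_algebra (traj E))) : \bar R :=
  (\esum_(w in S) (path_pmf pi n z w)%:E)%E.

Lemma path_law0 pi n z : path_law pi n z set0 = 0%E.
Proof. exact: esum_set0. Qed.

Lemma path_law_ge0 pi n z S : (0 <= path_law pi n z S)%E.
Proof. by apply: esum_ge0 => w _; rewrite lee_fin path_pmf_ge0. Qed.

Lemma path_law_sigma_additive pi n z : semi_sigma_additive (path_law pi n z).
Proof.
move=> F _ tF _; rewrite [X in _ --> X](_ : _ =
    \sum_(0 <= i <oo) path_law pi n z (F i))%E.
  by apply: is_cvg_ereal_nneg_natsum => i _; exact: path_law_ge0.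
rewrite nneseries_esumT; last by move=> i; exact: path_law_ge0.
by rewrite /path_law esum_bigcupT// => w; rewrite lee_fin path_pmf_ge0.
Qed.

HB.instance Definition _ pi n z := isMeasure.Build _ _ _ (path_law pi n z)
  (path_law0 pi n z) (path_law_ge0 pi n z) (@path_law_sigma_additive pi n z).

Lemma path_law_setT pi n z : path_law pi n z setT = 1%E.
Proof. exact: path_pmf_sum1. Qed.

HB.instance Definition _ pi n z := Measure_isProbability.Build _ _ _
  (path_law pi n z) (path_law_setT pi n z).

End path_law.

Section value.
Context (R : realType) (E : pointedType) (dA : measure_display).
Context (A : measurableType dA) (M : smdp R E A) (N : nat).
(* [rbar n x z a] is the one-stage reward for the transition from z to the
   state x under the action a at stage n. *)
Context (rbar : nat -> E -> E * nat -> A -> R) (g : E * nat -> R).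
Implicit Types (pi : policy M N) (f : decision_rule M) (v : E * nat -> R).

(* p(y|z,a), where z = (x, t): P(x,t+1|z,a) if y = x, and P(y,0|z,a) if not *)
Definition jump_prob (y : E) (z : E * nat) (a : A) : R :=
  if y == z.1 then trans M (z.1, z.2.+1) z a else trans M (y, 0%N) z a.

Definition reward n (z : E * nat) (a : A) : R :=
  asum [set: E] (fun x => rbar n x z a * jump_prob x z a).

Definition total_reward pi n (w : total_algebra (traj E)) : R :=
  \sum_(k < N | (n <= k)%N) reward k (process n k w) (pi k (process n k w))
  + g (process n N w).

Definition value_policy pi n z : \bar R :=
  ('E_(path_law pi n z) [total_reward pi n])%E.

Definition value n z : \bar R :=
  ereal_sup [set value_policy pi n z | pi in [set: policy M N]].

Definition optimal pi := forall n z, (n <= N)%N ->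
  value n z = value_policy pi n z.

Definition bellman_L n v (z : E * nat) (a : A) : R :=
  reward n z a + asum [set y | y != z.1] (fun y => v (y, 0%N) * jump_prob y z a)
  + v (z.1, z.2.+1) * jump_prob z.1 z a.

Definition bellman_Tf n f v (z : E * nat) : R := bellman_L n v z (f z).

Definition bellman_T n v (z : E * nat) : \bar R :=
  ereal_sup [set (bellman_L n v z a)%:E | a in adm M z].

Definition maximal n f v := forall z, bellman_T n v z = (bellman_Tf n f v z)%:E.

Definition bellman_solution (v : nat -> E * nat -> R) :=
  (forall z, v N z = g z) /\
  (forall n z, (n < N)%N -> (v n z)%:E = bellman_T n (v n.+1) z).

Definition reward_cvg := forall n z a, (n < N)%N -> adm M z a ->
  abs_cvg [set: E] (fun x => rbar n x z a * jump_prob x z a).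

(* Only the total reward has to be integrable, not each summand. *)
Definition value_cvg := forall pi n z, (n <= N)%N ->
  (path_law pi n z).-integrable setT (EFin \o total_reward pi n).

Definition bellman_cvg (v : nat -> E * nat -> R) := forall n z a, (n < N)%N ->
  adm M z a ->
  abs_cvg [set y | y != z.1] (fun y => v n.+1 (y, 0%N) * jump_prob y z a).

End value.

(* Main.v *)
(** Conditioning on the first transition gives, for every policy pi,
    V_{n,pi}(z) = r_n(z,a) + sum_y P(y|z,a) V_{n+1,pi}(y) with a = pi_n(z); this
    is Fubini for absolutely convergent sums over trajectories.  By (III) and
    (IV), L_n v(z,a) = r_n(z,a) + sum_y P(y|z,a) v(y).  Backward induction then
    yields V_{n,pi} <= v_n for every pi, with equality for a policy made of
    maximal decision rules. *)
Require Import Defs.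
From mathcomp Require Import all_boot all_order all_algebra.
From mathcomp Require Import boolp classical_sets functions cardinality.
From mathcomp Require Import reals ereal esum numfun measure lebesgue_integral.
From mathcomp Require Import probability.

Set Implicit Arguments.
Unset Strict Implicit.
Unset Printing Implicit Defensive.
Import Order.TTheory GRing.Theory Num.Theory.
Local Open Scope classical_set_scope.
Local Open Scope ring_scope.

(** * Linearity, monotonicity and splitting of absolutely convergent sums *)

Section asum_theory.
Context {R : realType} {T : choiceType}.
Implicit Types (D B : set T) (f g : T -> R).

Lemma eq_asum D f g : (forall x, D x -> f x = g x) -> asum D f = asum D g.
Proof.
move=> fg; congr (fine (_ - _)%E); apply: eq_esum => x /fg e.
  by rewrite !funeposE /= e.
by rewrite !funenegE /= e.
Qed.

Lemma eq_abs_cvg D f g : (forall x, D x -> f x = g x) ->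
  abs_cvg D f -> abs_cvg D g.
Proof.
move=> fg; apply: le_lt_trans.
by apply: le_esum => x /fg /= ->.
Qed.

Lemma fin_num_esum D (a : T -> \bar R) : summable D a ->
  (forall x, D x -> 0 <= a x)%E -> \esum_(x in D) a x \is a fin_num.
Proof.
rewrite summableE => + a0; rewrite (@eq_esum _ _ _ _ a)// => x /a0.
exact: gee0_abs.
Qed.

(** The sum of [f] can be computed from any difference of summable nonnegative functions, not only
    from its positive and negative parts. Additivity and Fubini both rest on this freedom. *)
Lemma asum_sub D f (a b : T -> \bar R) : summable D a -> summable D b ->
  (forall x, D x -> 0 <= a x)%E -> (forall x, D x -> 0 <= b x)%E ->
  (forall x, D x -> (f x)%:E = (a x - b x)%E) ->
  (asum D f)%:E = (\esum_(x in D) a x - \esum_(x in D) b x)%E.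
Proof.
move=> sa sb a0 b0 fab; rewrite -esumB// /asum.
rewrite (@eq_esum _ _ _ (EFin \o f)^\+%E (a \- b)^\+%E); last first.
  by move=> x /fab /= e; rewrite !funeposE /= e.
rewrite (@eq_esum _ _ _ (EFin \o f)^\-%E (a \- b)^\-%E); last first.
  by move=> x /fab e; rewrite !funenegE [(EFin \o f) x]e.
rewrite fineK// fin_numB !fin_num_esum//.
  exact/summable_funeneg/summableB.
exact/summable_funepos/summableB.
Qed.

Lemma EFin_funeposneg f x :
  (f x)%:E = ((EFin \o f)^\+ x - (EFin \o f)^\- x)%E.
Proof. exact: (congr1 (@^~ x) (funeposneg (EFin \o f))). Qed.

Lemma asumE D f : abs_cvg D f ->
  (asum D f)%:E =
  (\esum_(x in D) (EFin \o f)^\+ x - \esum_(x in D) (EFin \o f)^\- x)%E.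
Proof.
move=> sf; apply: asum_sub => //; first exact: summable_funepos.
  exact: summable_funeneg.
by move=> x _; exact: EFin_funeposneg.
Qed.

Lemma abs_cvgD D f g : abs_cvg D f -> abs_cvg D g ->
  abs_cvg D (fun x => f x + g x).
Proof. exact: summableD. Qed.

Lemma asumD D f g : abs_cvg D f -> abs_cvg D g ->
  asum D (fun x => f x + g x) = asum D f + asum D g.
Proof.
move=> sf sg; apply: EFin_inj.
rewrite EFinD (asumE sf) (asumE sg) addeACA -oppeD; last first.
  by rewrite fin_num_adde_defl// fin_num_esum//; exact: summable_funeneg.
(* The sums of the two positive parts and of the two negative parts decompose [f + g], although in
   general they are not its own positive and negative parts. *)
rewrite -!esumD//; apply: asum_sub => [||x _|x _|x _].
- by apply: summableD; exact: summable_funepos.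
- by apply: summableD; exact: summable_funeneg.
- by rewrite adde_ge0.
- by rewrite adde_ge0.
- rewrite EFinD (EFin_funeposneg f) (EFin_funeposneg g) addeACA -oppeD//.
  by rewrite fin_num_adde_defl// funenegE -EFinN -EFin_max.
Qed.

Lemma abs_cvgN D f : abs_cvg D f -> abs_cvg D (fun x => - f x).
Proof. by rewrite /abs_cvg summableN. Qed.

(** The negative part vanishes on [D]; if the positive part sums to infinity, [fine] returns 0,
    which is still nonnegative. *)
Lemma asum_ge0 D f : (forall x, D x -> 0 <= f x) -> 0 <= asum D f.
Proof.
move=> f0; rewrite /asum [X in (_ - X)%E]esum1 ?sube0.
  by apply/fine_ge0/esum_ge0.
by move=> x /f0 fx; rewrite funenegE; apply/max_idPr; rewrite lee_fin oppr_le0.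
Qed.

(** Additivity for [g = (g - f) + f] reduces the comparison to the sign of the sum of [g - f]. *)
Lemma ler_asum D f g : abs_cvg D f -> abs_cvg D g ->
  (forall x, D x -> f x <= g x) -> asum D f <= asum D g.
Proof.
move=> cf cg fg; rewrite -subr_ge0.
rewrite [X in X - _](@eq_asum _ _ (fun x => (g x - f x) + f x)); last first.
  by move=> x _; rewrite subrK.
rewrite asumD ?addrK//; last exact/abs_cvgD/abs_cvgN.
by apply: asum_ge0 => x /fg; rewrite subr_ge0.
Qed.

Lemma abs_cvgZ D (c : R) f : abs_cvg D f -> abs_cvg D (fun x => c * f x).
Proof.
move=> cf; rewrite /abs_cvg /summable.
under eq_esum do rewrite /= normrM EFinM.
rewrite esumZl//; exact: lte_mul_pinfty.
Qed.

Lemma asumN D f : abs_cvg D f -> asum D (fun x => - f x) = - asum D f.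
Proof.
move=> cf; apply/eqP; rewrite -addr_eq0 -asumD//; last exact: abs_cvgN.
by apply/eqP; rewrite /asum !esum1 ?sube0// => x _;
  rewrite ?funeposE ?funenegE /= addrC subrr ?oppr0 maxxx.
Qed.

Lemma asumZ D (c : R) f : abs_cvg D f ->
  asum D (fun x => c * f x) = c * asum D f.
Proof.
(* A nonnegative factor commutes with positive and negative parts; a negative [c] is reduced to
   [- c] by [asumN]. *)
wlog c0 : c / 0 <= c => [hwlog|] cf.
  have [/hwlog->//|/ltW c0] := leP 0 c.
  rewrite -[in RHS](opprK c) mulNr -hwlog ?oppr_ge0//.
  rewrite -asumN; last exact: abs_cvgZ.
  by apply: eq_asum => x _; rewrite mulNr opprK.
apply: EFin_inj; rewrite EFinM !asumE//; last exact: abs_cvgZ.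
rewrite muleBr//; last first.
  by rewrite fin_num_adde_defr// fin_num_esum//; exact: summable_funepos.
by rewrite -!esumZl//; congr (_ - _)%E; apply: eq_esum => x _;
  rewrite ?funeposE ?funenegE /= -!EFin_max -EFinM maxr_pMr// mulr0 ?mulrN.
Qed.

Lemma abs_cvg_set1 t f : abs_cvg [set t] f.
Proof. by rewrite /abs_cvg /summable esum_set1//= ltry. Qed.

Lemma asum_set1 t f : asum [set t] f = f t.
Proof.
apply: EFin_inj; rewrite asumE; last exact: abs_cvg_set1.
by rewrite !esum_set1//; exact/esym/EFin_funeposneg.
Qed.

Lemma abs_cvg_sub D B f : B `<=` D -> abs_cvg D f -> abs_cvg B f.
Proof.
move=> BD; apply: le_lt_trans; rewrite [leRHS](esumID B)// setIidr// leeDl//.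
exact: esum_ge0.
Qed.

Lemma abs_cvgID B D f : abs_cvg (D `&` B) f -> abs_cvg (D `&` ~` B) f ->
  abs_cvg D f.
Proof.
by move=> cB cC; rewrite /abs_cvg /summable (esumID B)// lte_add_pinfty.
Qed.

Lemma asumID B D f : abs_cvg D f ->
  asum D f = asum (D `&` B) f + asum (D `&` ~` B) f.
Proof.
move=> cf; have cB : abs_cvg (D `&` B) f by apply: abs_cvg_sub cf.
have cC : abs_cvg (D `&` ~` B) f by apply: abs_cvg_sub cf.
apply: EFin_inj; rewrite EFinD (asumE cf) (asumE cB) (asumE cC).
rewrite (@esumID _ _ B _ (EFin \o f)^\+%E)//.
rewrite (@esumID _ _ B _ (EFin \o f)^\-%E)//.
rewrite oppeD; first exact: addeACA.
by rewrite fin_num_adde_defl// fin_num_esum//; exact: summable_funeneg.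
Qed.

End asum_theory.

(** * Change of index along an injection *)

Section asum_reindex.
Context {R : realType} {T T' : choiceType}.
Implicit Types (D : set T) (B : set T').

(** Terms off the image of [e] vanish, and injectivity carries the sum over the image back to [D].
    It serves to discard trajectories and states of probability zero. *)
Lemma esum_image_support D B (e : T -> T') (a : T' -> \bar R) :
  set_inj D e -> (forall x, D x -> B (e x)) ->
  (forall y, B y -> 0 <= a y)%E ->
  (forall y, B y -> ~ (e @` D) y -> a y = 0%E) ->
  (\esum_(y in B) a y = \esum_(x in D) a (e x))%E.
Proof.
move=> inj DB a0 aout; rewrite (esumID (e @` D))// [X in (_ + X)%E]esum1.
  by rewrite adde0 setIidr ?esum_image// => _ [x /DB ? <-].
by move=> y [By Dy]; exact: aout.
Qed.

Lemma abs_cvg_image_support D B (e : T -> T') (f : T' -> R) :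
  set_inj D e -> (forall x, D x -> B (e x)) ->
  (forall y, B y -> ~ (e @` D) y -> f y = 0) ->
  abs_cvg B f <-> abs_cvg D (f \o e).
Proof.
move=> inj DB fout; rewrite /abs_cvg /summable.
rewrite (esum_image_support inj DB)// => y By yD.
by rewrite /= fout// normr0.
Qed.

Lemma asum_image_support D B (e : T -> T') (f : T' -> R) :
  set_inj D e -> (forall x, D x -> B (e x)) ->
  (forall y, B y -> ~ (e @` D) y -> f y = 0) ->
  asum B f = asum D (f \o e).
Proof.
move=> inj DB fout; rewrite /asum !(esum_image_support inj DB)//.
- by congr (fine (_ - _)%E); apply: eq_esum => x _; rewrite ?funeposE ?funenegE.
- by move=> y By yD; rewrite funenegE /= fout// oppr0 maxxx.
- by move=> y By yD; rewrite funeposE /= fout// maxxx.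
Qed.

End asum_reindex.

(** * Tonelli and Fubini for sums over pairs *)

Section asum_fubini.
Context {R : realType} {T T' : choiceType}.
Implicit Types (f : T * T' -> R).

Lemma esum_pair (a : T * T' -> \bar R) : (forall q, 0 <= a q)%E ->
  (\esum_(q in setT) a q = \esum_(x in setT) \esum_(y in setT) a (x, y))%E.
Proof.
move=> a0; rewrite (esum_esum (a := fun x y => a (x, y)))//.
rewrite (_ : setT `*`` _ = setT); last by apply/seteqP.
by apply: eq_esum => -[].
Qed.

Lemma abs_cvg_snd f x : abs_cvg setT f -> abs_cvg setT (fun y => f (x, y)).
Proof.
move=> cf.
rewrite -(@abs_cvg_image_support _ _ _ _ [set (x, y) | y in setT] (pair x) f).
- exact: abs_cvg_sub cf.
- by move=> y y' _ _ [].
- by move=> y _; exists y.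
- by [].
Qed.

(** By Tonelli, the inner sums [p] and [q] of the positive and negative parts are summable. Their
    difference is the inner sum of [f], so [asum_sub] applies to them. *)
Lemma asum_pair f : abs_cvg setT f ->
  abs_cvg setT (fun x => asum setT (fun y => f (x, y))) /\
  asum setT f = asum setT (fun x => asum setT (fun y => f (x, y))).
Proof.
move=> cf.
pose p x := (\esum_(y in setT) (EFin \o f)^\+ (x, y))%E.
pose q x := (\esum_(y in setT) (EFin \o f)^\- (x, y))%E.
have p0 x : (0 <= p x)%E by exact: esum_ge0.
have q0 x : (0 <= q x)%E by exact: esum_ge0.
have sp : summable setT p.
  have := summable_funepos cf; rewrite /summable esum_pair//.
  apply: le_lt_trans; apply: le_esum => x _; rewrite gee0_abs//.
  by apply: le_esum => y _; rewrite gee0_abs.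
have sq : summable setT q.
  have := summable_funeneg cf; rewrite /summable esum_pair//.
  apply: le_lt_trans; apply: le_esum => x _; rewrite gee0_abs//.
  by apply: le_esum => y _; rewrite gee0_abs.
have fpq x : (asum setT (fun y => f (x, y)))%:E = (p x - q x)%E.
  rewrite asumE; last exact: abs_cvg_snd.
  by congr (_ - _)%E; apply: eq_esum => y _; rewrite ?funeposE ?funenegE.
split.
  have := summableB sp sq; apply: le_lt_trans; apply: le_esum => x _.
  by rewrite [(EFin \o _) x]fpq.
by apply: EFin_inj; rewrite (asum_sub sp sq)// asumE// !esum_pair.
Qed.

End asum_fubini.

(** * From integrals on countable discrete spaces to sums *)

Lemma ge0_integral_countable (R : realType) (T : pointedType)
    (mu : {measure set (total_algebra T) -> \bar R}) (f : T -> \bar R) :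
  countable [set: T] -> (forall x, 0 <= f x)%E ->
  (\int[mu]_x f x = \esum_(x in [set: T]) (f x * mu [set x]))%E.
Proof.
move=> /countable_injP[h /in2TT hinj] f0.
pose F (i : nat) : set (total_algebra T) := [set x | h x = i].
have FT : [set: total_algebra T] = \bigcup_i F i.
  by apply/seteqP; split => // x _; exists (h x).
have tF : trivIset setT F by move=> i j _ _ [x [<- <-]].
rewrite FT ge0_integral_bigcup// esum_bigcupT//; last first.
  by move=> x; rewrite mule_ge0.
rewrite nneseries_esumT; last by move=> i; exact: integral_ge0.
apply: eq_esum => i _.
(* By injectivity of [h] a fibre is empty or a singleton, and on a singleton the integrand is
   constant. *)
have [F0|/set0P[x Fx]] := eqVneq (F i) set0.
  by rewrite F0 integral_set0 esum_set0.
have -> : F i = [set x].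
  by apply/seteqP; split => [y|_ ->//]; rewrite -Fx => /hinj.
rewrite esum_set1 ?mule_ge0//.
rewrite (eq_integral (cst (f x))) ?integral_cst// => y.
by rewrite inE => ->.
Qed.

(** Transfers the total mass 1 of [trans] and [path_pmf], known as extended sums, to real sums. *)
Lemma ge0_asumE (R : realType) (T : choiceType) (D : set T) (f : T -> R)
    (r : R) :
  (forall x, D x -> 0 <= f x) -> (\esum_(x in D) (f x)%:E = r%:E)%E ->
  abs_cvg D f /\ asum D f = r.
Proof.
move=> f0 fr; have cf : abs_cvg D f.
  rewrite /abs_cvg /summable (@eq_esum _ _ _ _ (EFin \o f)) ?fr ?ltry//.
  by move=> x /f0 fx; rewrite /= ger0_norm.
split=> //; apply: EFin_inj; rewrite -fr.
rewrite (asum_sub (a := EFin \o f) (b := cst 0%E))// => [||x _].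
- by rewrite [X in (_ - X)%E]esum1 ?sube0.
- by rewrite /summable esum1 ?ltry// => x _ /=; rewrite normr0.
- by rewrite sube0.
Qed.

(** * Expectations as sums over trajectories *)

Section paths.
Context (R : realType) (E : pointedType) (cE : countable [set: E]).
Context (dA : measure_display) (A : measurableType dA) (M : smdp R E A).
Context (N : nat).
Implicit Types (pi : policy M N) (n : nat) (z : E * nat).

(** An injection of [E] into the naturals extends to states, then letterwise to finite sequences,
    which are encoded by [pickle]. *)
Lemma countable_traj : countable [set: traj E].
Proof.
have /countable_injP[h /in2TT hinj] := cE.
pose k (z : E * nat) := (h z.1, z.2).
have kinj : injective k by move=> [x s] [y t] [/hinj -> ->].
apply/countable_injP; exists (pickle \o map k) => w1 w2 _ _ /=.
by move=> /(pcan_inj pickleK)/(inj_map kinj).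
Qed.

Lemma path_law_set1 pi n z w : path_law pi n z [set w] = (path_pmf pi n z w)%:E.
Proof. by rewrite /path_law esum_set1// lee_fin path_pmf_ge0. Qed.

Lemma expectation_path_law pi n z (X : traj E -> R) :
  (path_law pi n z).-integrable setT (EFin \o X) ->
  abs_cvg setT (fun w => path_pmf pi n z w * X w) /\
  'E_(path_law pi n z)[X]%E = (asum setT (fun w => path_pmf pi n z w * X w))%:E.
Proof.
move=> iX.
have intE (a : traj E -> \bar R) : (forall w, 0 <= a w)%E ->
    (\int[path_law pi n z]_w a w =
     \esum_(w in setT) (a w * (path_pmf pi n z w)%:E))%E.
  move=> a0; rewrite ge0_integral_countable//; last exact: countable_traj.
  by apply: eq_esum => w _; congr (_ * _)%E; exact: path_law_set1.
have cX : abs_cvg setT (fun w => path_pmf pi n z w * X w).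
  have /integrableP[_] := iX; rewrite intE// => /le_lt_trans; apply.
  apply: le_esum => w _.
  by rewrite /= -EFinM normrM (ger0_norm (path_pmf_ge0 _ _ _ _)) mulrC.
split => //; rewrite unlock integralE asumE// !intE//.
(* The weights [path_pmf] are nonnegative, hence pass through positive and negative parts. *)
by congr (_ - _)%E; apply: eq_esum => w _;
  rewrite ?funeposE ?funenegE /= -!EFin_max -EFinM mulrC
    maxr_pMr ?path_pmf_ge0// mulr0 ?mulrN.
Qed.

End paths.

(** * One-step recursion for policy values and the operator [bellman_L] *)

Section value.
Context (R : realType) (E : pointedType) (cE : countable [set: E]).
Context (dA : measure_display) (A : measurableType dA) (M : smdp R E A).
Context (N : nat).
Context (rbar : nat -> E -> E * nat -> A -> R) (g : E * nat -> R).
Implicit Types (pi : policy M N) (n : nat) (z : E * nat).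

(** Real-valued form of [value_policy], with which it agrees up to the horizon by
    [value_policyE]. *)
Definition value_policyR pi n z : R :=
  asum setT (fun w => path_pmf pi n z w * total_reward rbar g pi n w).
Local Notation V := value_policyR.

Context (vcvg : value_cvg M N rbar g).

Lemma value_policyE pi n z : (n <= N)%N ->
  value_policy rbar g pi n z = (V pi n z)%:E.
Proof.
move=> nN; rewrite /value_policy.
by rewrite (expectation_path_law cE (vcvg pi z nN)).2.
Qed.

(** At the horizon only the trajectory [[:: z]] has positive probability, and the sum of stage
    rewards is empty. *)
Lemma value_policy_end pi z : V pi N z = g z.
Proof.
rewrite /value_policyR (@asum_image_support _ _ _ [set [:: z]] _ id).
- rewrite asum_set1 /= path_pmf_end// eqxx mul1r /total_reward /process subnn.
  rewrite big_pred0 ?add0r//.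
  by move=> k; apply/negbTE; rewrite -ltnNge ltn_ord.
- by [].
- by [].
- move=> w _ wz; rewrite path_pmf_end//.
  case: eqP => [wE|_]; last by rewrite mul0r.
  by exfalso; apply: wz; exists w.
Qed.

(** Positions in a trajectory are counted from its starting time, so dropping the head is matched by
    raising the start from [n] to [n.+1]. *)
Lemma total_reward_cons pi n (nN : (n < N)%N) z w :
  total_reward rbar g pi n (z :: w) =
  reward M rbar n z (pi (Ordinal nN) z) + total_reward rbar g pi n.+1 w.
Proof.
rewrite /total_reward (bigD1 (Ordinal nN))//= /process subnn /= -addrA.
rewrite -(subnSK nN) /=; congr (_ + (_ + _)).
apply: eq_big => [k|k /andP[nk kn]].
  by rewrite ltn_neqAle andbC eq_sym.
have nk' : (n < k)%N by rewrite ltn_neqAle nk eq_sym andbT.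
by rewrite -(subnSK nk').
Qed.

Lemma value_policy_rec pi n (nN : (n < N)%N) z (a := pi (Ordinal nN) z) :
  abs_cvg setT (fun y => trans M y z a * V pi n.+1 y) /\
  V pi n z =
    reward M rbar n z a + asum setT (fun y => trans M y z a * V pi n.+1 y).
Proof.
have adma : adm M z a by exact: rule_adm.
set r := reward M rbar n z a.
pose T := total_reward rbar g pi n.+1.
(* As [n < N], every trajectory of positive probability starts with [z] and has a second state; [e]
   parametrises these by the second state and the remainder. *)
pose e (q : (E * nat) * traj E) : traj E := [:: z, q.1 & q.2].
have einj : set_inj setT e by move=> [y w] [y' w'] _ _ [-> ->].
have supp w : ~ (e @` setT) w ->
    path_pmf pi n z w * total_reward rbar g pi n w = 0.
  case: w => [|x [|y w]] we.
  - by rewrite path_pmf_head ?mul0r.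
  - by rewrite /path_pmf/= -(subnSK nN)/= mul0r.
  - rewrite path_pmf_head ?mul0r// => w' [xz _]; apply: we.
    by exists (y, w) => //; rewrite xz.
have supp' y w : ~ (cons y @` setT) w -> path_pmf pi n.+1 y w = 0.
  move=> we; rewrite path_pmf_head// => w' wE.
  by apply: we; exists w'.
pose h (q : (E * nat) * traj E) :=
  trans M q.1 z a * (path_pmf pi n.+1 q.1 (q.1 :: q.2) * (r + T (q.1 :: q.2))).
have hE q : path_pmf pi n z (e q) * total_reward rbar g pi n (e q) = h q.
  by rewrite /e (path_pmf_cons pi z _ _ nN) total_reward_cons -mulrA.
have ch : abs_cvg setT h.
  have /(abs_cvg_image_support einj) :=
    (expectation_path_law cE (vcvg pi z (ltnW nN))).1.
  move=> /(_ (fun _ _ => I) (fun w _ => @supp w)).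
  by apply: eq_abs_cvg => q _; exact: hE.
(* Sum over the continuations from [y]: the constant [r] is weighted by total mass 1, and the future
   reward contributes [V pi n.+1 y]. *)
have hV y : asum setT (fun w => h (y, w)) = trans M y z a * (r + V pi n.+1 y).
  have cT := (expectation_path_law cE (vcvg pi y nN)).1.
  have [cp p1] := ge0_asumE (fun w _ => path_pmf_ge0 pi n.+1 y w)
    (path_pmf_sum1 pi n.+1 y).
  have inj : set_inj setT (cons y) by move=> ? ? _ _ [].
  have cG : abs_cvg setT (fun w => path_pmf pi n.+1 y w * (r + T w)).
    apply: eq_abs_cvg (abs_cvgD (abs_cvgZ r cp) cT) => w _.
    by rewrite [RHS]mulrDr [r * _]mulrC.
  have GE : asum setT (fun w => path_pmf pi n.+1 y w * (r + T w)) =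
      r + V pi n.+1 y.
    rewrite (@eq_asum _ _ _ _ (fun w =>
      r * path_pmf pi n.+1 y w + path_pmf pi n.+1 y w * T w)).
      by rewrite asumD//; [rewrite asumZ// p1 mulr1|exact: abs_cvgZ].
    by move=> w _; rewrite mulrDr [r * _]mulrC.
  rewrite -GE [in RHS](asum_image_support inj (B := setT))//; last first.
    by move=> w _ /supp' ->; rewrite mul0r.
  rewrite -asumZ//.
  apply: (iffLR (abs_cvg_image_support inj (B := setT) _ _)) cG => // w _.
  by move=> /supp' ->; rewrite mul0r.
have [cS SE] := asum_pair ch.
have trE := ge0_asumE (fun y _ => trans_ge0 y adma) (trans_sum1 adma).
(* Fubini only gives convergence of the series with terms [trans M y z a * (r + V pi n.+1 y)];
   subtracting the convergent series of [r * trans M y z a] leaves the one wanted. *)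
have cV : abs_cvg setT (fun y => trans M y z a * V pi n.+1 y).
  apply: eq_abs_cvg (abs_cvgD cS (abs_cvgZ (- r) trE.1)) => y _.
  by rewrite hV mulrDr [_ * r]mulrC mulNr addrAC subrr add0r.
split=> //.
rewrite /value_policyR (asum_image_support einj (B := setT))//; last first.
  by move=> w _; exact: supp.
(* The factor 1 is replaced by the total mass of the kernel, so that [r] can be brought under the
   sum. *)
rewrite -[r]mulr1 -trE.2 -asumZ ?trE.1// -asumD//; last exact/abs_cvgZ/trE.1.
transitivity (asum setT h); first by apply: eq_asum => q _; exact: hE.
rewrite SE; apply: eq_asum => y _.
by rewrite hV mulrDr [_ * r]mulrC.
Qed.

(** Puts [bellman_L] in the same shape as the recursion for policy values. The full series differs
    from the jump series only by the single term at [(x, t.+1)], so convergence carries over. *)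
Lemma bellman_LE n (u : E * nat -> R) z a : adm M z a ->
  abs_cvg [set y | y != z.1] (fun y => u (y, 0%N) * jump_prob M y z a) ->
  abs_cvg setT (fun w => trans M w z a * u w) /\
  bellman_L M rbar n u z a =
    reward M rbar n z a + asum setT (fun w => trans M w z a * u w).
Proof.
case: z => x t /= adma cu.
pose e (y : E) := (y, 0%N).
pose B := [set (x, t.+1)].
pose h w := trans M w (x, t) a * u w.
have einj : set_inj [set y | y != x] e by move=> ? ? _ _ [].
have eB y : y != x -> (~` B) (e y) by move=> /eqP yx [].
(* Outside [B] and the states [(y, 0)] with [y != x] the kernel vanishes: [trans_stay] covers the
   states over [x], including [(x, 0)], and [trans_jump] the others. *)
have supp w : (~` B) w -> ~ (e @` [set y | y != x]) w -> h w = 0.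
  move=> wB we; rewrite /h; case: w wB we => y s wB we.
  have [yx|/eqP yx] := eqVneq y x.
    rewrite yx trans_stay ?mul0r// => st; apply: wB.
    by rewrite yx st.
  rewrite trans_jump ?mul0r// => s0; apply: we; exists y; first exact/eqP.
  by rewrite s0.
have he y : y != x -> (h \o e) y = u (y, 0%N) * jump_prob M y (x, t) a.
  by move=> yx; rewrite /h /= /jump_prob (negbTE yx) mulrC.
have ch : abs_cvg setT h.
  apply: (@abs_cvgID _ _ B); rewrite setTI; first exact: abs_cvg_set1.
  apply/(abs_cvg_image_support einj eB supp).
  by apply: eq_abs_cvg cu => y /he.
split=> //; rewrite (asumID B)// !setTI asum_set1.
rewrite (asum_image_support einj eB supp).
rewrite /bellman_L /= -addrA; congr (_ + _); rewrite addrC; congr (_ + _).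
  by rewrite /h /jump_prob eqxx mulrC.
by apply: eq_asum => y /he.
Qed.

End value.

(** * Backward induction from the horizon *)

Theorem theorem3p6 (R : realType) (E : pointedType)
  (cE : countable [set: E])
  (dA : measure_display) (A : measurableType dA) (M : smdp R E A)
  (N : nat) (N_gt0 : (0 < N)%N)
  (rbar : nat -> E -> E * nat -> A -> R) (g : E * nat -> R)
  (rcvg : reward_cvg M N rbar) (vcvg : value_cvg M N rbar g)
  (v : nat -> E * nat -> R) (Lcvg : bellman_cvg M N v)
  (vB : bellman_solution M N rbar g v)
  (pistar : policy M N)
  (pimax : forall n : 'I_N, maximal rbar n (pistar n) (v n.+1)) :
  optimal rbar g pistar /\
  forall (n : nat) (z : E * nat), (n <= N)%N ->
    value M N rbar g n z = value_policy rbar g pistar n z /\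
    value_policy rbar g pistar n z = (v n z)%:E.
Proof.
have [vN vn] := vB.
have LE n (nN : (n < N)%N) z a (az : adm M z a) :=
  bellman_LE rbar n az (Lcvg n z a nN az).
(* Descending induction, obtained by writing [n] as [N - (N - n)] and inducting on [N - n]. *)
have back (Q : nat -> Prop) : Q N -> (forall n, (n < N)%N -> Q n.+1 -> Q n) ->
    forall n, (n <= N)%N -> Q n.
  move=> QN Qs n /subKn <-; elim: (N - n)%N (leq_subr n N) => [|d IH] dN.
    by rewrite subn0.
  by apply: Qs; rewrite subnSK ?leq_subr//; exact/IH/ltnW.
have star n : (n <= N)%N -> forall z,
    value_policy rbar g pistar n z = (v n z)%:E.
  move: n; apply: back => [z|n nN IH z].
    by rewrite value_policyE// value_policy_end vN.
  rewrite value_policyE; [|exact: cE|exact: vcvg|exact: ltnW].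
  have [_ ->] := value_policy_rec cE vcvg pistar nN z.
  (* Maximality means that the supremum defining [v n z] is attained at the action of [pistar]; both
     sides then have the same one-step form. *)
  rewrite vn// (pimax (Ordinal nN)) /bellman_Tf.
  have [_ ->] := LE n nN z _ (rule_adm (pistar (Ordinal nN)) z).
  congr (_ + _)%:E.
  apply: eq_asum => y _; congr (_ * _); apply: EFin_inj.
  by rewrite -value_policyE.
have upper (pi : policy M N) n : (n <= N)%N -> forall z,
    (value_policy rbar g pi n z <= (v n z)%:E)%E.
  move: n; apply: back => [z|n nN IH z].
    by rewrite value_policyE// value_policy_end vN.
  rewrite value_policyE; [|exact: cE|exact: vcvg|exact: ltnW].
  rewrite vn//; apply: ereal_sup_ge.
  set a := pi (Ordinal nN) z; have az : adm M z a by exact: rule_adm.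
  (* The action chosen by [pi] competes in the supremum defining [v n z]. It remains to compare two
     series with the same nonnegative weights, termwise by the induction hypothesis. *)
  exists (bellman_L M rbar n (v n.+1) z a)%:E; first by exists a.
  have [cV ->] := value_policy_rec cE vcvg pi nN z.
  have [cv ->] := LE n nN z a az.
  rewrite lee_fin lerD2l; apply: ler_asum => // y _.
  apply: ler_wpM2l; first exact: trans_ge0.
  by rewrite -lee_fin -value_policyE.
have valueE n z : (n <= N)%N ->
    value M N rbar g n z = value_policy rbar g pistar n z.
  (* All policy values lie below [v n z], and [pistar] reaches it. *)
  move=> nN; apply/eqP; rewrite eq_le; apply/andP; split.
    by apply: ge_ereal_sup => _ [pi _ <-]; rewrite (star _ nN); exact: upper.
  by apply: ereal_sup_ubound; exists pistar.
by split=> n z nN; [exact: valueE|split; [exact: valueE|exact: star]].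
Qed.
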